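(* The product of an arbitrary family of compact Kempisty spaces is a Kempisty space.
   Context: A topological space is Baire if every countable intersection of dense open subsets is dense. A mapping $g:X\to Z$ between topological spaces is quasi-continuous if for every $x_0\in X$, every neighborhood $U$ of $x_0$ and every neighborhood $V$ of $g(x_0)$ there is a nonempty open in $X$ set $G\subseteq U$ with $g(G)\subseteq V$. A function $f:X\times Y\to\mathbb R$ is quasi-continuous in the first variable if $x\mapsto f(x,y)$ is quasi-continuous for each $y\in Y$, and continuous in the second variable if $y\mapsto f(x,y)$ is continuous for each $x\in X$. A mapping $f:X\times Y\to Z$ has the Namioka property if there exists a dense in $X$ $G_\delta$-set $A\subseteq X$ such that $f$ is jointly continuous at each point of $A\times Y$. A topological space $Y$ is a Kempisty space if for every Baire space $X$ every function $f:X\times Y\to\mathbb R$ which is quasi-continuous in the first variable and continuous in the second variable has the Namioka property. Products carry the product topology. *)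

(* Defs.v *)
From mathcomp Require Import all_boot all_order all_algebra all_classical all_reals.
From mathcomp Require Import topology normedtype borel_hierarchy.
Export numFieldNormedType.Exports.

Set Implicit Arguments.
Unset Strict Implicit.
Unset Printing Implicit Defensive.

Local Open Scope classical_set_scope.

Definition baire_space (X : topologicalType) : Prop :=
  forall F : nat -> set X,
    (forall n, open (F n) /\ dense (F n)) -> dense (\bigcap_n F n).

Definition quasi_continuous (X Z : topologicalType) (g : X -> Z) : Prop :=
  forall (x0 : X) (U : set X) (V : set Z), nbhs x0 U -> nbhs (g x0) V ->
    exists G : set X, [/\ open G, G !=set0, G `<=` U & g @` G `<=` V].

Definition namioka_property (X Y Z : topologicalType) (f : X * Y -> Z) : Prop :=
  exists A : set X, [/\ dense A, Gdelta A &
    forall x y, A x -> {for (x, y), continuous f}].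

Definition kempisty_space (R : realType) (Y : topologicalType) : Prop :=
  forall (X : topologicalType) (f : X * Y -> R), baire_space X ->
    (forall y : Y, quasi_continuous (fun x : X => f (x, y))) ->
    (forall x : X, continuous (fun y : Y => f (x, y))) ->
    namioka_property f.

(* Main.v *)
Require Import Defs.
From mathcomp Require Import all_boot all_order all_algebra all_classical all_reals.
From mathcomp Require Import topology normedtype borel_hierarchy.
From mathcomp Require Import lra.

(** Fix a Baire space X and a function f on X times the product, quasi-continuous
    in x and continuous in y.  For compact Y the Namioka property is equivalent
    to a statement about oscillations: every nonempty open U contains a nonempty
    open V on which the maps f(x, .), x in V, are uniformly within a prescribed
    e of one another.  This is [fragmented]; [namioka_fragmented] and
    [fragmented_namioka] are the two directions.  It remains to pass from the
    factors to the product, first for two factors, then for infinitely many.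

    Both passages have the same shape.  If every open set had large oscillation,
    one could keep shrinking an open set while recording, at each step, a witness
    of the bad behaviour that is new with respect to all former witnesses.  As X
    is Baire, some such run has a point x in all its open sets
    ([banach_mazur_stuck], the Banach-Mazur game), and then the single function
    f(x, .), continuous on a compact space, exhibits infinitely many independent
    witnesses, which is impossible.  So the process gets stuck, and an open set on
    which it is stuck has small oscillation.

    Two factors K and L ([fragmented_prod]).  The witnesses are points b of L,
    and b is new at x when sup_k |f(x, k, b) - f(x, k, b')| > d for all the
    recorded b'.  Compactness forbids an infinite d-separated sequence
    ([no_separated_sequence]).  To see that a stuck open set has small
    oscillation, take a finite net of K which is fine for all the finitely many
    recorded functions f(x, ., b').  The maps f(., c, .), for c in the net, have
    small oscillation after shrinking.  If f still oscillated much at some (a, b),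
    then f(x, a, b) would differ from f(x, c, b), with c near a in the net, while
    f(x, a, b') is close to f(x, c, b') for the recorded b'; so b would be new.

    Infinitely many factors ([fragmented_prod_topology]).  Fix a point z, and let
    [merge s y z] agree with y at the finitely many indices in s and with z
    elsewhere.  The two-factor case and induction show that f(x, merge s y z) is
    fragmented.  The witnesses are finite index sets s, and a larger s' is new at
    x when changing y only at indices in s' but not in s can change f(x, y) by
    more than d.  In an infinite run these sets of indices would be disjoint, and
    compactness of the product forbids that ([no_escaping_jumps]). *)

Import Order.TTheory GRing.Theory Num.Theory.

Set Implicit Arguments.
Unset Strict Implicit.
Unset Printing Implicit Defensive.

Local Open Scope classical_set_scope.
Local Open Scope ring_scope.

(** * Oscillation and the Namioka property *)

Definition osc_le {R : realType} {X T : Type} (g : X -> T -> R) (V : set X)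
  (e : R) := forall x x' t, V x -> V x' -> `|g x t - g x' t| <= e.

(** Equivalently, for every e the points near which x |-> g(x, .) oscillates by at
    most e, for the uniform distance, form a dense open set.  Stated with local
    open sets V, it can be used inside any open set without passing to a
    subspace. *)
Definition fragmented {R : realType} {X : topologicalType} {T : Type}
  (g : X -> T -> R) := forall (e : R) (U : set X), 0 < e -> open U -> U !=set0 ->
  exists V, [/\ open V, V !=set0, V `<=` U & osc_le g V e].

Lemma osc_leS (R : realType) (X T : Type) (g : X -> T -> R) (U V : set X) e :
  V `<=` U -> osc_le g U e -> osc_le g V e.
Proof. by move=> VU gU x x' t /VU Ux /VU Ux'; exact: gU. Qed.

Lemma fragmented_seq (R : realType) (X : topologicalType) (T C : Type)
    (g : C -> X -> T -> R) (s : list C) (e : R) (U : set X) :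
  (forall c, fragmented (g c)) -> 0 < e -> open U -> U !=set0 ->
  exists V, [/\ open V, V !=set0, V `<=` U &
    forall c, List.In c s -> osc_le (g c) V e].
Proof.
move=> fg e0 oU U0; elim: s => [|c s [V [oV V0 VU Vs]]]; first by exists U; split.
have [W [oW W0 WV Wc]] := fg c e V e0 oV V0.
exists W; split => //; first exact: subset_trans VU.
by move=> d [<-//|/Vs Vd]; exact: osc_leS Vd.
Qed.

Lemma near_close (R : realType) (Z : Type) (F : set_system Z) {FF : Filter F}
    (g : Z -> R) (l e : R) :
  0 < e -> g @ F --> l -> \forall z \near F, `|g z - l| < e.
Proof.
by move=> e0 /cvgrPdist_lt/(_ e e0); apply: filterS => z; rewrite distrC.
Qed.

(** The tube lemma, for an arbitrary filter in place of neighborhoods. *)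
Lemma compact_forall_near (S : Type) (F : set_system S) (K : topologicalType)
    (P : S -> K -> Prop) :
  Filter F -> compact [set: K] ->
  (forall k : K, \forall k' \near k & s \near F, P s k') ->
  \forall s \near F, forall k, P s k.
Proof.
move=> FF cK PF.
have := (compact_near_coveringP [set: K]).1 cK _ F P FF (fun k _ => PF k).
by apply: filterS => s sP k; exact: sP.
Qed.

(** The filter of all large enough finite subsets of C.  Lists stand for finite
    sets, since the set of indices of the product carries no equality test. *)
Definition seq_incl (C : Type) : set_system (list C) :=
  filter_from [set: list C] (fun s => [set s' | List.incl s s']).
Arguments seq_incl : clear implicits.

#[global] Instance seq_incl_proper (C : Type) : ProperFilter (seq_incl C).
Proof.
apply: filter_from_proper; last by move=> s _; exists s; exact: List.incl_refl.
apply: filter_from_filter; first by exists [::].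
move=> s s' _ _; exists (s ++ s') => // u uss'.
by split=> c cs; apply: uss'; apply: List.in_or_app; [left|right].
Qed.

Lemma compact_net (K : topologicalType) (E : K -> set K) :
  compact [set: K] -> (forall c, nbhs c (E c)) ->
  exists s : list K, forall k, exists2 c, List.In c s & E c k.
Proof.
move=> cK nE.
suff /filter_ex[s sP] : \forall s \near seq_incl K,
    forall k, exists2 c, List.In c s & E c k by exists s.
apply: compact_forall_near => // k.
exists (E k, [set s | List.incl [:: k] s]) => /=.
  by split; [exact: nE|exists [:: k]].
by move=> [k' s] /= [Ek' ks]; exists k => //; apply: ks; left.
Qed.

(** A dense set of points of joint continuity meets U, and around such a point
    the tube lemma makes the continuity uniform in y. *)
Lemma namioka_fragmented (R : realType) (X Y : topologicalType) (f : X * Y -> R) :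
  compact [set: Y] -> namioka_property f -> fragmented (fun x y => f (x, y)).
Proof.
move=> cY [A [dA _ fA]] e U e0 oU U0.
have [x [Ux Ax]] := dA U U0 oU.
have e2 : 0 < e / 2 by lra.
have : \forall x' \near x, forall y, `|f (x', y) - f (x, y)| < e / 2.
  apply: compact_forall_near => // y.
  have e4 : 0 < e / 4 by lra.
  have [[P Q] /= [xP yQ] PQ] := near_close e4 (fA x y Ax).
  exists (Q, P) => // -[y' x'] /= [Qy' Px'].
  have /= h1 := PQ (x', y') (conj Px' Qy').
  have /= h2 := PQ (x, y') (conj (nbhs_singleton xP) Qy').
  have := ler_distD (f (x, y)) (f (x', y')) (f (x, y')).
  rewrite (distrC (f (x, y))); lra.
move=> nx; set N := [set x' | forall y, `|f (x', y) - f (x, y)| < e / 2] in nx.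
exists (U `&` N°); split; first by apply: openI => //; exact: open_interior.
- by exists x.
- by move=> z [].
move=> z z' y [_ /interior_subset/(_ y) h1] [_ /interior_subset/(_ y) h2].
have := ler_distD (f (x, y)) (f (z, y)) (f (z', y)).
rewrite (distrC (f (x, y))); lra.
Qed.

(** The points that have, for each n, a neighborhood of oscillation at most
    1/(n+1) form a dense G-delta, by Baire category; near such an x, all
    f(x', .) are uniformly close to f(x, .), which is continuous. *)
Lemma fragmented_namioka (R : realType) (X Y : topologicalType) (f : X * Y -> R) :
  baire_space X -> (forall x, continuous (fun y => f (x, y))) ->
  fragmented (fun x y => f (x, y)) -> namioka_property f.
Proof.
move=> bX fc ff.
pose O n := \bigcup_(V in [set V | open V /\
  osc_le (fun x y => f (x, y)) V n.+1%:R^-1]) V.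
have Oo n : open (O n) by apply: bigcup_open => V [].
exists (\bigcap_n O n); split.
- apply: bX => n; split=> // W W0 oW.
  have [|V [oV [x Vx] VW Vn]] := ff n.+1%:R^-1 W _ oW W0.
    by rewrite invr_gt0 ltr0n.
  by exists x; split; [exact: VW|exists V].
- by exists O.
move=> x y Ox; apply/cvgrPdist_lt => e e0.
have e2 : 0 < e / 2 by lra.
have [n] := ltr_add_invr e2; rewrite add0r => ne.
have [V [oV Vn] Vx] := Ox n I.
exists (V, [set y' | `|f (x, y') - f (x, y)| < e / 2]) => /=.
  by split; [exact: open_nbhs_nbhs|exact: near_close (fc x y)].
move=> [x' y'] /= [Vx' h1].
have /= h2 := le_lt_trans (Vn x' x y' Vx' Vx) ne.
have := ler_distD (f (x, y')) (f (x', y')) (f (x, y)).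
rewrite (distrC (f (x, y))); lra.
Qed.

(** A difference g - h of quasi-continuous functions need not be
    quasi-continuous, so |g - h| > c at a point says nothing about nearby points.
    Here h hardly varies on V whereas g varies a lot, so g and h differ at one of
    the two given points, and near that point only g has to be controlled. *)
Lemma quasi_continuous_gap (R : realType) (X : topologicalType) (g h : X -> R)
    (V : set X) (c d : R) x x' :
  quasi_continuous g -> open V -> V x -> V x' -> 0 < d ->
  (forall z z', V z -> V z' -> `|h z - h z'| <= d) ->
  2 * c + 5 * d < `|g x - g x'| ->
  exists G, [/\ open G, G !=set0, G `<=` V & forall z, G z -> c < `|g z - h z|].
Proof.
move=> qg oV Vx Vx' d0 hV gxx'.
suff [z Vz gz] : exists2 z, V z & c + 2 * d < `|g z - h z|.
  have [||G [oG G0 GV gG]] := qg z V (ball (g z) d).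
  - by apply: open_nbhs_nbhs.
  - exact: nbhsx_ballx.
  exists G; split => // w Gw.
  have h1 : ball (g z) d (g w) by apply: gG; exists w.
  rewrite -ball_normE /= in h1.
  have h2 := hV w z (GV _ Gw) Vz.
  have := ler_distD (g w) (g z) (h z).
  have := ler_distD (h w) (g w) (h z); lra.
have [gx|gx] := ltP (c + 2 * d) `|g x - h x|; first by exists x.
exists x' => //.
have h2 := hV x x' Vx Vx'.
have := ler_distD (h x) (g x) (g x'); have := ler_distD (h x') (h x) (g x').
rewrite (distrC (h x') (g x')); lra.
Qed.

(** * The Banach-Mazur game *)

(** The states of the game are pairs (U, t) of an open set and a record t.  If
    every state could be continued inside every smaller open set, one would
    choose for each state a maximal disjoint family of continuations, whose union
    is dense by maximality.  The levels of the resulting tree are disjoint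
    families with dense union, so by the Baire property some point x lies in the
    union of every level; by disjointness the states that contain x form one
    branch, and this is an infinite run around x. *)
Lemma banach_mazur_stuck (X : topologicalType) (T : Type)
    (P : set X -> T -> Prop) (S : X -> T -> T -> Prop) :
  baire_space X ->
  (forall U V t, V `<=` U -> P U t -> P V t) ->
  (forall x (t : nat -> T), ~ forall n, S x (t n) (t n.+1)) ->
  forall U t, open U -> U !=set0 -> P U t ->
  exists U' t', [/\ open U', U' !=set0, U' `<=` U, P U' t' &
    forall V t'', open V -> V !=set0 -> V `<=` U' -> P V t'' ->
      ~ forall x, V x -> S x t' t''].
Proof.
move=> baireX Pmono nochain U t oU U0 PUt; apply: contrapT => noterm.
pose valid (s : set X * T) := [/\ open s.1, s.1 !=set0, s.1 `<=` U & P s.1 s.2].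
have move_ex s : valid s -> exists s' : set X * T,
    [/\ valid s', s'.1 `<=` s.1 & forall x, s'.1 x -> S x s.2 s'.2].
  move=> [os s0 sU Ps]; apply: contrapT => noV; apply: noterm.
  exists s.1, s.2; split => // V t'' oV V0 Vs PV SV; apply: noV.
  by exists (V, t''); split => //; split => //=; exact: subset_trans sU.
pose E (s : set X * T) := [set s' : set X * T |
  [/\ valid s', s'.1 `<=` s.1 & forall x, s'.1 x -> S x s.2 s'.2]].
have Dex (s : set X * T) := ex_maximal_disjoint_subcollection fst (E s).
pose D s := sval (Dex s).
have D_E s : D s `<=` E s by have [] := svalP (Dex s).
have D_triv s : trivIset (D s) fst by have [] := svalP (Dex s).
have D_dense s W : valid s -> open W -> W `&` s.1 !=set0 ->
    exists2 s', D s s' & W `&` s'.1 !=set0.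
  move=> [os s0 sU Ps] oW Ws0; apply: contrapT => noD.
  have [|s' [vs' s's Ss']] := move_ex (W `&` s.1, s.2).
    split => //=; first exact: openI.
      by move=> x [_ /sU].
    by apply: Pmono Ps => x [].
  have s'W : s'.1 `<=` W by move=> x /s's[].
  have nDs' s'' : D s s'' -> ~ (s''.1 `&` s'.1 !=set0).
    move=> Ds'' [x [xs'' xs']]; apply: noD; exists s'' => //.
    by exists x; split => //; exact: s'W.
  have s'0 : s'.1 !=set0 by case: vs'.
  have [_ _ /(_ (D s `|` [set s']))] := svalP (Dex s); apply.
  - split; first by move=> u Du; left.
    move=> /(_ s' (or_intror erefl)) Ds'; case: s'0 => x s'x.
    by apply: (nDs' s') => //; exists x.
  - move=> u [/D_E//|->]; split => //; first by move=> x /s's[].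
  - move=> i j [Di|->] [Dj|->] ij //; first exact: (D_triv s).
      by case: (nDs' _ Di).
    by case: (nDs' _ Dj); rewrite setIC.
(* The n-th level of the tree of states. *)
pose L := fix L n : set (set X * T) :=
  if n is m.+1 then \bigcup_(s in L m) D s else [set (U, t)].
have Lvalid n : L n `<=` valid.
  case: n => [|n] s /=; first by move=> ->; split.
  by move=> [u _ /D_E[]].
have Ltriv n : trivIset (L n) fst.
  elim: n => [|n IH] /=; first by move=> i j -> ->.
  move=> i j [u Lu Di] [v Lv Dj] ij.
  suff uv : u = v by apply: (D_triv u) => //; rewrite uv.
  apply: IH => //; case: ij => x [xi xj]; exists x; split.
    by have [_ + _] := D_E _ _ Di; exact.
  by have [_ + _] := D_E _ _ Dj; exact.
pose O n := \bigcup_(s in L n) s.1.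
have Oopen n : open (O n) by apply: bigcup_open => s /Lvalid[].
have Odense n W : open W -> W `&` U !=set0 -> W `&` O n !=set0.
  move=> oW WU; elim: n => [|n [x [Wx [s Ls xs]]]].
    by case: WU => x [Wx Ux]; exists x; split => //; exists (U, t).
  have [|s' Ds' [z [Wz zs']]] := D_dense s W (Lvalid _ _ Ls) oW.
    by exists x.
  by exists z; split => //; exists s' => //; exists s.
(* Density is only known inside U; adding the exterior of U makes it global. *)
pose G n := O n `|` (~` U)°.
have Gbaire : dense (\bigcap_n G n).
  apply: baireX => n; split; first by apply: openU => //; exact: open_interior.
  move=> W W0 oW; have [WU|WU] := pselect (W `&` U !=set0).
    by have [x [Wx Ox]] := Odense n W oW WU; exists x; split => //; left.
  have [x Wx] := W0; exists x; split => //; right.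
  apply: filterS (open_nbhs_nbhs (conj oW Wx)) => z Wz Uz; apply: WU.
  by exists z.
have [x [Ux Gx]] := Gbaire U U0 oU.
have Ox n : exists s, L n s /\ s.1 x.
  case: (Gx n I) => [[s]|]; first by exists s.
  by move=> /interior_subset /(_ Ux).
have [s sP] := choice Ox.
apply: (nochain x (fun n => (s n).2)) => n.
have [[u Lu Du] xs] := sP n.+1.
have [_ su uS] := D_E _ _ Du.
have us : u = s n.
  have [Ln xn] := sP n.
  by apply: (Ltriv n) => //; exists x; split => //; exact: su.
by rewrite -us; exact: uS.
Qed.

(** * Two compact factors *)

(** By compactness of K, the map l |-> g(., l) is continuous for the uniform
    distance, so terms of the sequence near a cluster point are close. *)
Lemma no_separated_sequence (R : realType) (K L : topologicalType)
    (g : K -> L -> R) (d : R) (b : nat -> L) :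
  compact [set: K] -> compact [set: L] ->
  continuous (fun kl : K * L => g kl.1 kl.2) -> 0 < d ->
  ~ forall m n, (m < n)%N -> exists k, d < `|g k (b n) - g k (b m)|.
Proof.
move=> cK cL gc d0 bsep.
have equi (l : L) : \forall l' \near l, forall k, `|g k l' - g k l| < d / 2.
  apply: compact_forall_near => // k.
  have d4 : 0 < d / 4 by lra.
  have [[P Q] /= [kP lQ] PQ] := near_close d4 (gc (k, l)).
  exists (P, Q) => // -[k' l'] /= [Pk' Ql'].
  have /= h1 := PQ (k', l') (conj Pk' Ql').
  have /= h2 := PQ (k', l) (conj Pk' (nbhs_singleton lQ)).
  have := ler_distD (g k l) (g k' l') (g k' l).
  rewrite (distrC (g k l)); lra.
have [|l [_ lb]] := cL (b @ \oo) _; first exact: filterT.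
have bgt N : (b @ \oo) (b @` [set n | (N <= n)%N]).
  by exists N => // n /= Nn; exists n.
have [_ [[m _ <-] /= hm]] := lb _ _ (bgt 0%N) (equi l).
have [_ [[n mn <-] /= hn]] := lb _ _ (bgt m.+1) (equi l).
have [k] := bsep m n mn.
have := ler_distD (g k l) (g k (b n)) (g k (b m)).
rewrite (distrC (g k l)); have := hm k; have := hn k; lra.
Qed.

(** The record is the list of the points b of L already used, together with the
    condition that f(., ., b) hardly oscillates on the current open set.  That
    condition makes one net of K, fine at a single x0, fine at all points of the
    open set. *)
Lemma fragmented_prod (R : realType) (X K L : topologicalType)
    (f : X -> K -> L -> R) :
  baire_space X -> compact [set: K] -> compact [set: L] ->
  (forall x, continuous (fun kl : K * L => f x kl.1 kl.2)) ->
  (forall k l, quasi_continuous (fun x => f x k l)) ->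
  (forall l, fragmented (fun x k => f x k l)) ->
  (forall k, fragmented (fun x l => f x k l)) ->
  fragmented (fun x (kl : K * L) => f x kl.1 kl.2).
Proof.
move=> bX cK cL fc fq fK fL e U e0 oU U0.
(* The gap lemma is used with c = 5 d below, and 2 c + 5 d = 15 d = e. *)
pose d := e / 15; have d0 : 0 < d by rewrite /d; lra.
pose P (V : set X) (t : list L) :=
  forall l, List.In l t -> osc_le (fun x k => f x k l) V d.
pose S x (t t' : list L) := exists2 l, t' = l :: t &
  forall l', List.In l' t -> exists k, d < `|f x k l - f x k l'|.
have Pmono V W t : W `<=` V -> P V t -> P W t.
  by move=> WV PV l /PV; exact: osc_leS.
have nochain x (t : nat -> list L) : ~ forall n, S x (t n) (t n.+1).
  move=> tS.
  have tS' n : exists l : L, t n.+1 = l :: t n /\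
      forall l', List.In l' (t n) -> exists k, d < `|f x k l - f x k l'|.
    by have [l] := tS n; exists l.
  have [l lP] := choice tS'.
  apply: (no_separated_sequence (b := l) cK cL (fc x) d0) => m n.
  move=> mn; apply: (lP n).2; elim: n mn => // n IH.
  by rewrite ltnS leq_eqVlt (lP n).1 => /orP[/eqP ->|/IH]; [left|right].
have [V [t [oV V0 VU Pt stop]]] :=
  banach_mazur_stuck bX Pmono nochain oU U0 (t := [::]) (fun _ => False_ind _).
have [x0 Vx0] := V0.
have [|cs csP] := @compact_net K (fun c => [set k |
    forall l, List.In l t -> `|f x0 k l - f x0 c l| < d]) cK.
  move=> c; elim: t {Pt stop} => [|l t IH]; first by apply: nearW => k l.
  have [[A B] /= [cA lB] AB] := near_close d0 (fc x0 (c, l)).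
  apply: filterS (filterI cA IH) => k [Ak kt] l' [<-|/kt//].
  exact: (AB (k, l) (conj Ak (nbhs_singleton lB))).
have [W [oW W0 WV Wcs]] := fragmented_seq
    (g := fun k x l => f x k l) cs fL d0 oV V0.
exists W; split => //; first exact: subset_trans VU.
move=> x x' [a b] Wx Wx' /=; rewrite leNgt; apply/negP => big.
have [c cc ac] := csP a.
have [|G [oG G0 GW Gbig]] := quasi_continuous_gap (c := 5 * d)
    (fq a b) oW Wx Wx' d0
    (fun z z' Vz Vz' => Wcs c cc z z' b Vz Vz').
  by rewrite /d; rewrite /d in big; lra.
have [H [oH H0 HG Hb]] := fK b d G d0 oG G0.
apply: (stop H (b :: t) oH H0).
- exact: subset_trans (subset_trans GW WV).
- move=> l [<-//|lt]; apply: osc_leS (Pt _ lt).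
  exact: subset_trans (subset_trans GW WV).
move=> z Hz; exists b => // l lt.
have Vz : V z by apply/WV/GW/HG.
have h0 := Gbig z (HG _ Hz).
have h1 := Pt l lt z x0 a Vz Vx0.
have h2 := Pt l lt x0 z c Vx0 Vz.
have h3 := ac l lt.
rewrite /= in h1 h2.
(* Four errors of at most d separate the gap 5 d, at b, from the gap at l:
   three in comparing (a, l) with (c, l) through x0, and one at the other of
   a and c; so the distance between b and l exceeds d at a or at c. *)
have [ha|ha] := ltP d `|f z a b - f z a l|; first by exists a.
exists c.
have := ler_distD (f z a l) (f z a b) (f z c b).
have := ler_distD (f z c l) (f z a l) (f z c b).
have := ler_distD (f x0 a l) (f z a l) (f z c l).
have := ler_distD (f x0 c l) (f x0 a l) (f z c l).
rewrite (distrC (f z c l) (f z c b)); lra.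
Qed.

(** * Products of compact spaces *)

Lemma cluster_subfilter (S : Type) (T : topologicalType) (F : set_system S)
    (u : S -> T) (p : T) :
  Filter F -> cluster (u @ F) p ->
  exists G, [/\ ProperFilter G, F `<=` G & u @ G --> p].
Proof.
move=> FF up.
exists (filter_from [set AB : set S * set T | F AB.1 /\ nbhs p AB.2]
  (fun AB => AB.1 `&` u @^-1` AB.2)); split.
- apply: filter_from_proper; last first.
    move=> [A B] /= [FA nB].
    have FuA : F (u @^-1` (u @` A)) by apply: filterS FA; exact: preimage_image.
    by have [_ [[s As <-] Bs]] := up _ _ FuA nB; exists s.
  apply: filter_from_filter; first by exists (setT, setT); split; exact: filterT.
  move=> [A B] [A' B'] /= [FA nB] [FA' nB'].
  exists (A `&` A', B `&` B'); first by split; exact: filterI.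
  by move=> s /= [[As A's] [Bs B's]].
- by move=> A FA; exists (A, setT); [split => //; exact: filterT|move=> s []].
- by move=> B nB; exists (setT, B); [split => //; exact: filterT|move=> s []].
Qed.

Lemma cvg_prod_topology (I S : Type) (Y : I -> topologicalType)
    (F : set_system S) {FF : Filter F}
    (u : S -> prod_topology Y) (y : prod_topology Y) :
  (forall i, (fun s => u s i) @ F --> y i) -> u @ F --> y.
Proof.
move=> uy; apply/cvg_sup => i U [V] [[W] oW <-] Wyi WU.
apply: (filterS WU); apply: uy; exact: open_nbhs_nbhs.
Qed.

Lemma coord_continuous (I : Type) (Y : I -> topologicalType) (i : I) :
  continuous (fun y : prod_topology Y => y i).
Proof. exact: (@proj_continuous {classic I} Y i). Qed.

Lemma compact_prod_topology (I : Type) (Y : I -> topologicalType) :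
  (forall i, compact [set: Y i]) -> compact [set: prod_topology Y].
Proof.
move=> cY; have := @tychonoff {classic I} Y (fun i => setT) cY.
by congr (compact _); apply/seteqP; split.
Qed.

(** Along a filter for which y converges, y' converges coordinatewise, hence in
    the product, to the same point; the jumps of g thus tend to 0 along it. *)
Lemma no_escaping_jumps (R : realType) (I : Type) (Y : I -> topologicalType)
    (g : prod_topology Y -> R) (d : R) (y y' : nat -> prod_topology Y) :
  (forall i, compact [set: Y i]) -> continuous g -> 0 < d ->
  (forall i, \forall n \near \oo, y n i = y' n i) ->
  ~ forall n, d < `|g (y n) - g (y' n)|.
Proof.
move=> cY gc d0 yy' jump.
have [|p [_ /cluster_subfilter[G [GP ooG yp]]]] :=
  compact_prod_topology cY (F := y @ \oo) _; first exact: filterT.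
have y'p : y' @ G --> p.
  apply: cvg_prod_topology => i.
  apply: (@cvg_trans _ ((fun n => y n i) @ G)).
    by apply: near_eq_cvg; apply: ooG; exact: yy'.
  apply: (cvg_comp y (fun q : prod_topology Y => q i) yp).
  exact: coord_continuous.
have d2 : 0 < d / 2 by lra.
have hy : \forall n \near G, `|g (y n) - g p| < d / 2
  by exact: near_close d2 (cvg_comp y g yp (gc p)).
have hy' : \forall n \near G, `|g (y' n) - g p| < d / 2
  by exact: near_close d2 (cvg_comp y' g y'p (gc p)).
have [n [h h']] := filter_ex (filterI hy hy').
have := jump n; have := ler_distD (g p) (g (y n)) (g (y' n)).
rewrite /= in h h'; rewrite (distrC (g p)); lra.
Qed.

Definition merge (I : Type) (Y : I -> Type) (s : list I) (y z : forall i, Y i) :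
    forall i, Y i :=
  fun i => if pselect (List.In i s) then y i else z i.

Lemma merge_in (I : Type) (Y : I -> Type) (s : list I) (y z : forall i, Y i) i :
  List.In i s -> merge s y z i = y i.
Proof. by rewrite /merge; case: pselect. Qed.

Lemma merge_out (I : Type) (Y : I -> Type) (s : list I) (y z : forall i, Y i) i :
  ~ List.In i s -> merge s y z i = z i.
Proof. by rewrite /merge; case: pselect. Qed.

(** The right-hand side is a function of two variables, evaluated at (y, y i);
    the case of two factors applies to that function. *)
Lemma merge_cons (I : Type) (Y : I -> Type) (i : I) (s : list I)
    (y z : forall i, Y i) :
  merge (i :: s) y z = merge s y (@dfwith {classic I} Y z i (y i)).
Proof.
apply: functional_extensionality_dep => j.
have [js|js] := pselect (List.In j s); first by rewrite !merge_in//; right.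
rewrite [RHS]merge_out//; have [<-|ij] := pselect (i = j).
  by rewrite merge_in ?dfwithin//; left.
by rewrite merge_out ?dfwithout//; [exact/eqP|move=> []].
Qed.

Lemma merge_cvg (I : Type) (Y : I -> topologicalType) (y z : prod_topology Y) :
  ((fun s => merge s y z) : list I -> prod_topology Y) @ seq_incl I --> y.
Proof.
apply: cvg_prod_topology => i; apply: cvg_near_cst.
by exists [:: i] => //= s si; rewrite merge_in//; apply: si; left.
Qed.

Lemma merge_dfwith_continuous (I : Type) (Y : I -> topologicalType) (s : list I)
    (i : I) (z : prod_topology Y) :
  continuous (fun ab : prod_topology Y * Y i =>
    merge s ab.1 (@dfwith {classic I} Y z i ab.2) : prod_topology Y).
Proof.
move=> [a b]; apply: cvg_prod_topology => j /=.
rewrite /merge; case: pselect => js /=.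
  apply: (cvg_comp fst (fun y : prod_topology Y => y j)); first exact: cvg_fst.
  exact: coord_continuous.
rewrite /dfwith; case: eqP => [ij|_]; last exact: cvg_cst.
by case: _ / ij; exact: cvg_snd.
Qed.

(** Induction on s.  With one more index i, f becomes a function on the product
    of the whole product space, seen through the indices in s, and of Y i.
    Freezing the second variable gives the induction hypothesis with another z,
    freezing the first gives the Kempisty property of Y i. *)
Lemma fragmented_merge (R : realType) (I : Type) (Y : I -> topologicalType)
    (X : topologicalType) (f : X -> prod_topology Y -> R) (s : list I) :
  baire_space X -> (forall i, compact [set: Y i]) ->
  (forall i, kempisty_space R (Y i)) ->
  (forall y, quasi_continuous (fun x => f x y)) ->
  (forall x, continuous (f x)) ->
  forall z : prod_topology Y,
    fragmented (fun x (y : prod_topology Y) => f x (merge s y z)).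
Proof.
move=> bX cY kY fq fc; elim: s => [|i s IH] z.
  move=> e U e0 oU [x Ux].
  have e2 : 0 < e / 2 by lra.
  have [||G [oG G0 GU Gf]] := fq z x U (ball (f x z) (e / 2)).
  - exact: open_nbhs_nbhs.
  - exact: nbhsx_ballx.
  exists G; split => // w w' y Gw Gw'.
  have -> : merge [::] y z = z.
    by apply: functional_extensionality_dep => j; rewrite merge_out.
  have h : ball (f x z) (e / 2) (f w z) by apply: Gf; exists w.
  have h' : ball (f x z) (e / 2) (f w' z) by apply: Gf; exists w'.
  rewrite -!ball_normE /= in h h'.
  have := ler_distD (f x z) (f w z) (f w' z).
  rewrite (distrC (f w z) (f x z)); lra.
pose put (ab : prod_topology Y * Y i) : prod_topology Y :=
  merge s ab.1 (@dfwith {classic I} Y z i ab.2).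
have fputc x : continuous (fun ab => f x (put ab)).
  move=> ab; apply: (cvg_comp put (f x)); last exact: fc.
  exact: merge_dfwith_continuous.
have fput : fragmented (fun x ab => f x (put (ab.1, ab.2))).
  apply: (fragmented_prod (f := fun x a b => f x (put (a, b)))) => //.
  - exact: compact_prod_topology.
  - by move=> b; exact: (IH (@dfwith {classic I} Y z i b)).
  - move=> a; apply: (namioka_fragmented (f := fun p => f p.1 (put (a, p.2)))) => //.
    apply: kY => [//|b|x b /=]; first exact: (fq (put (a, b))).
    have pairc : (fun b => (a, b)) @ b --> (a, b).
      have := @cvg_pair _ _ _ (nbhs b) (nbhs a) (nbhs b) _ _ _ (fun=> a) id.
      by apply; [exact: cvg_cst|exact: cvg_id].
    exact: (cvg_comp (pair a) (fun ab => f x (put ab)) pairc (fputc x (a, b))).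
move=> e U e0 oU U0; have [V [oV V0 VU Vf]] := fput e U e0 oU U0.
exists V; split => // x x' y Vx Vx'.
by rewrite merge_cons; exact: (Vf x x' (y, y i)).
Qed.

(** A run is a growing sequence of finite sets of indices.  A point y at which f
    oscillates can be replaced by one that agrees with z outside a finite set t,
    as these are dense; this t is the next record. *)
Lemma fragmented_prod_topology (R : realType) (I : Type) (Y : I -> topologicalType)
    (X : topologicalType) (f : X -> prod_topology Y -> R) :
  baire_space X -> (forall i, compact [set: Y i]) ->
  (forall i, kempisty_space R (Y i)) ->
  (forall y, quasi_continuous (fun x => f x y)) ->
  (forall x, continuous (f x)) -> fragmented f.
Proof.
move=> bX cY kY fq fc e U e0 oU U0.
have [[z]|noz] := pselect (inhabited (prod_topology Y)); last first.
  by exists U; split => // x x' y; case: noz.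
(* One unit of d is lost when y is truncated; the gap lemma takes the other 7. *)
pose d := e / 8; have d0 : 0 < d by rewrite /d; lra.
pose S x (s s' : list I) := List.incl s s' /\ exists y y' : prod_topology Y,
  (forall i, List.In i s \/ ~ List.In i s' -> y i = y' i) /\
  d < `|f x y - f x y'|.
have nochain x (s : nat -> list I) : ~ forall n, S x (s n) (s n.+1).
  move=> sS.
  have sincl m n : (m <= n)%N -> List.incl (s m) (s n).
    elim: n => [|n IH].
      by rewrite leqn0 => /eqP ->; exact: List.incl_refl.
    rewrite leq_eqVlt => /orP[/eqP ->|/IH mn]; first exact: List.incl_refl.
    exact: List.incl_tran mn (sS n).1.
  have [y yP] := choice (fun n => (sS n).2).
  have [y' y'P] := choice yP.
  apply: (no_escaping_jumps (y := y) (y' := y') cY (fc x) d0) => [i|n]; last first.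
    exact: (y'P n).2.
  (* An index lies in at most one of the differences of consecutive sets. *)
  have [[m im]|nos] := pselect (exists m, List.In i (s m)).
    by exists m => // n /= mn; apply: (y'P n).1; left; exact: sincl im.
  by exists 0%N => // n _; apply: (y'P n).1; right => im; apply: nos; exists n.+1.
have [V [s [oV V0 VU _ stop]]] := banach_mazur_stuck
  (P := fun _ _ => True) bX (fun _ _ _ _ => id) nochain oU U0 (t := [::]) Logic.I.
have [W [oW W0 WV Ws]] := fragmented_merge s bX cY kY fq fc z d0 oV V0.
exists W; split => //; first exact: subset_trans VU.
move=> x x' y Wx Wx'; rewrite leNgt; apply/negP => big.
have d2 : 0 < d / 2 by lra.
have near_merge w : \forall t \near seq_incl I,
    `|f w (merge t y z) - f w y| < d / 2.
  apply: (near_close (g := fun t => f w (merge t y z))) => //.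
  apply: (@cvg_comp _ _ _
    (fun t : list I => (merge t y z : prod_topology Y)) (f w)
    (seq_incl I) (nbhs y) (nbhs (f w y))); last exact: fc.
  exact: merge_cvg.
have s_near : \forall t \near seq_incl I, List.incl s t by exists s.
have [t [[hx hx'] st]] :=
  filter_ex (filterI (filterI (near_merge x) (near_merge x')) s_near).
rewrite /= in hx hx'.
pose u : prod_topology Y := merge t y z.
have [|G [oG G0 GW Gbig]] := quasi_continuous_gap (c := d) (fq u) oW Wx Wx' d0
    (fun w w' Ww Ww' => Ws w w' u Ww Ww').
  have := ler_distD (f x u) (f x y) (f x' y).
  have := ler_distD (f x' u) (f x u) (f x' y).
  rewrite -/u in hx hx'; rewrite (distrC (f x y) (f x u)).
  rewrite /d in hx hx' *; lra.
apply: (stop G t oG G0 _ Logic.I); first exact: subset_trans WV.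
move=> w Gw; split => //; exists u, (merge s u z); split; last exact: Gbig.
move=> i [is_|it]; first by rewrite merge_in.
by rewrite merge_out ?/u ?merge_out// => /st.
Qed.

Theorem theorem4p6 (R : realType) (I : Type) (Y : I -> topologicalType)
  (cptY : forall i : I, compact [set: Y i])
  (kemY : forall i : I, kempisty_space R (Y i)) :
  kempisty_space R (prod_topology Y).
Proof.
move=> X f bX fq fc; apply: fragmented_namioka => //.
exact: (fragmented_prod_topology (f := fun x y => f (x, y))).
Qed.
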